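(* Let $G$ be a finite multigraph with two distinct edges $e$ and $e'$, each incident to the vertices $x$ and $y$. Then $H_*(G)\cong H_*(G-e')$ as bigraded $\mathfrak S_n$-modules, where $n=|V(G)|$ and $H_*$ is chromatic symmetric homology.
   Context: Graphs are finite; loops and multiple edges are allowed. $V=V(G)=\{v_1,\dots,v_n\}$, $E=E(G)=\{e_1,\dots,e_m\}$ with a fixed enumeration of the edges; $G-e'$ denotes deletion of the edge $e'$ (same vertex set, inherited edge order). $\mathfrak S_V\cong\mathfrak S_n$ is the symmetric group on $V$; representations are over $\mathbb C$; $\mathcal S^\lambda$ is the Specht module indexed by $\lambda\vdash n$. States and modules. A state of $G$ is a spanning subgraph, identified with its edge set $F\subseteq E$. For $a\ge1$ let $\mathcal L_a=\bigoplus_{i=0}^{a-1}\mathcal S^{(a-i,1^i)}$, graded with $\mathcal S^{(a-i,1^i)}$ in degree $i$; equivalently $\mathcal L_a\cong\bigwedge^*\mathcal S^{(a-1,1)}$ with the exterior grading (for $a=1$ put $\mathcal S^{(0,1)}=0$). If the connected components of $(V,F)$ have vertex sets $B_1,\dots,B_r$ of sizes $b_1,\dots,b_r$, let $\mathfrak S_F=\mathfrak S_{B_1}\times\cdots\times\mathfrak S_{B_r}$ and $\mathcal M_F=\mathrm{Ind}_{\mathfrak S_F}^{\mathfrak S_V}(\mathcal L_{b_1}\otimes\cdots\otimes\mathcal L_{b_r})$, a graded $\mathfrak S_V$-module. Concretely: realise $\mathcal S^{(b-1,1)}$ for a $b$-element set $B$ as $W_B=\{x\in\mathbb C^B:\sum_{v\in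 B}x_v=0\}$, put $W_F=\bigoplus_kW_{B_k}\subseteq\mathbb C^V$; then $\mathcal L_{b_1}\otimes\cdots\otimes\mathcal L_{b_r}=\bigwedge^*W_F$ and $\mathcal M_F=\mathbb C[\mathfrak S_V]\otimes_{\mathbb C[\mathfrak S_F]}\bigwedge^*W_F$. Chain modules: $C_{i,j}(G)=\bigoplus_{|F|=i}(\mathcal M_F)_j$, $C_i(G)=\bigoplus_jC_{i,j}(G)$. Per-edge maps: let $F'=F-e$ with $e\in F$; write $\varepsilon$ for the corresponding edge of the Boolean lattice of states. If $F$ and $F'$ have the same components, $d_\varepsilon:\mathcal M_F\to\mathcal M_{F'}$ is the identity. Otherwise a component of $F$ splits into two components $A,B$ of $F'$. In the case that $F$ has only one component, $\mathrm{Res}_{\mathfrak S_A\times\mathfrak S_B}W_V=\mathcal T\oplus\mathbf 1$ with $\mathcal T=W_A\oplus W_B$ and $\mathbf 1$ trivial, so $\mathrm{Res}\,\bigwedge^*W_V=\bigwedge^*\mathcal T\oplus(\bigwedge^*\mathcal T)[1]$, where $(\bigwedge^*\mathcal T)[1]=\bigwedge^*\mathcal T\wedge\mathbf 1$, and $d_\varepsilon$ is the map corresponding under Frobenius reciprocity to the $(\mathfrak S_A\times\mathfrak S_B)$-map that is the identity on $\bigwedge^*\mathcal T$ and zero on $(\bigwedge^*\mathcal T)[1]$. In general $d_\varepsilon$ is obtained by tensoring this map with the identity on the factors of the other components and inducing to $\mathfrak S_V$. Explicitly, $d_\varepsilon(g\otimes x)=\sum_{h\in\mathfrak S_F/\mathfrak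 S_{F'}}gh\otimes(\bigwedge^*\pi)(h^{-1}x)$, where $\pi:W_F\to W_{F'}$ is the orthogonal projection. Signs and differential: encode $F$ by the binary string $z_1\cdots z_m$ with $z_i=1$ if $e_i\in F$ and $z_i=0$ otherwise. If $e=e_k$, $\mathrm{sgn}(\varepsilon)=(-1)^{s}$, where $s$ is the number of ones in positions after the $k$th. Set $d_i=\sum_\varepsilon\mathrm{sgn}(\varepsilon)d_\varepsilon:C_i(G)\to C_{i-1}(G)$, the sum over all $\varepsilon$ from a state with $i$ edges to one with $i-1$ edges, and $d_{i,j}:C_{i,j}(G)\to C_{i-1,j}(G)$ its degree $j$ part. Homology: $H_{i,j}(G)=\ker d_{i,j}/\mathrm{im}\,d_{i+1,j}$ and $H_*(G)=\bigoplus_{i,j\ge0}H_{i,j}(G)$. *)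

(* Defs.v *)
From HB Require Import structures.
From mathcomp Require Import all_boot all_order all_algebra all_fingroup.

Set Implicit Arguments.
Unset Strict Implicit.
Unset Printing Implicit Defensive.

Import GroupScope Order.TTheory GRing.Theory Num.Theory.
Local Open Scope ring_scope.

(* A loop has one endpoint, any other edge has two; the edges are enumerated
   by 'I_m, and distinct edges may have the same endpoints. *)
Record mgraph (V : finType) (m : nat) := MGraph {
  ends : 'I_m -> {set V};
  ends_card : forall k, (0 < #|ends k| <= 2)%N }.

(* [lift e'] is the increasing enumeration of the edges other than e'. *)
Definition delete_edge (V : finType) (m : nat) (G : mgraph V m) (e' : 'I_m) :
    mgraph V m.-1 :=
  {| ends := fun k => ends G (lift e' k);
     ends_card := fun k => ends_card G (lift e' k) |}.

(* The quotient A/B of two subspaces B <= A of E, realised inside E as a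
   complement of B in A; [quot_pi A B] is the canonical projection (see
   [quot_pi_img] and [quot_pi_eq0]). *)
Section Quotient.
Variables (K : fieldType) (E : vectType K).
Implicit Types A B : {vspace E}.

Definition quotv A B : {vspace E} := (A :\: B)%VS.
Definition quot_pi A B : 'End(E) := addv_pi1 A B.

Fact quot_pi_img A B : (quot_pi A B @: A)%VS = quotv A B.
Proof.
apply/eqP; rewrite eqEsubv; apply/andP; split; apply/subvP=> x.
  by case/memv_imgP=> y _ ->; exact: memv_pi.
move=> xA; apply/memv_imgP; exists x; first exact: (subvP (diffvSl A B)).
by rewrite /quot_pi /addv_pi1 daddv_pi_id ?capv_diff.
Qed.

Fact quot_pi_eq0 A B x : x \in A -> (quot_pi A B x == 0) = (x \in B).
Proof.
move=> xA; have xAB : x \in (A + B)%VS by exact: (subvP (addvSl A B)).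
have := addv_pi1_pi2 xAB; rewrite -/(quot_pi A B) => Ex.
apply/eqP/idP=> [x0|xB]; first by rewrite -Ex x0 add0r memv_pi.
have: quot_pi A B x \in ((A :\: B) :&: B)%VS.
  rewrite memv_cap memv_pi /=.
  have -> : quot_pi A B x = x - addv_pi2 A B x by rewrite -{2}Ex addrK.
  by rewrite rpredB // memv_pi.
by rewrite capv_diff memv0 => /eqP.
Qed.

End Quotient.

Section ChromaticHomology.
Variables (K : numClosedFieldType) (V : finType).

Local Notation vec := {ffun V -> K^o}.
(* The j-th tensor power of K^V. *)
Local Notation tens j := {ffun {ffun 'I_j -> V} -> K^o}.
(* K[S_V] (x)_K (K^V)^{(x) j}; the value at g is the coefficient of g. *)
Local Notation gtens j := {ffun {perm V} -> tens j}.

(* The product of S_V as a group of functions: (s * t)%g applies s first. *)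
Definition pcomp (s t : {perm V}) : {perm V} := (t * s)%g.

Fact pcompE s t v : pcomp s t v = s (t v).
Proof. exact: permM. Qed.

(* The exterior power of W is the space of antisymmetric tensors spanned by the
   w_1 /\ ... /\ w_j = \sum_s sgn(s) w_(s 1) (x) ... (x) w_(s j), w_a in W;
   it suffices to take the w_a in a basis of W, see [wedge_extpow]. *)
Definition wedge j (w : 'I_j -> vec) : tens j :=
  [ffun t : {ffun 'I_j -> V} => \det (\matrix_(a, b) (w a (t b) : K))].

Definition extpow j (W : {vspace vec}) : {vspace tens j} :=
  <<[seq wedge (fun a => (vbasis W)`_(s a)) | s : {ffun 'I_j -> 'I_(\dim W)}]>>%VS.

Definition unitv (v : V) : vec := [ffun u => (u == v)%:R].

(* f (x) ... (x) f; it induces the j-th exterior power of f, see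
   [extmap_wedge]. *)
Definition extmap j (f : 'End(vec)) (x : tens j) : tens j :=
  [ffun t : {ffun 'I_j -> V} =>
    \sum_(s : {ffun 'I_j -> V}) (\prod_b f (unitv (s b)) (t b)) * x s].

Definition vact (h : {perm V}) (w : vec) : vec := [ffun v => w ((h^-1)%g v)].

Definition tact j (h : {perm V}) (x : tens j) : tens j :=
  [ffun t : {ffun 'I_j -> V} => x [ffun b => (h^-1)%g (t b)]].

(* g (x) x *)
Definition gten j (g : {perm V}) (x : tens j) : gtens j :=
  [ffun g' => if g' == g then x else 0].

(* s (g (x) x) = sg (x) x *)
Definition gact j (s : {perm V}) (a : gtens j) : gtens j :=
  \sum_g gten (pcomp s g) (a g).

Fact extmap_is_linear j f : linear (@extmap j f).
Proof.
move=> k x y; apply/ffunP=> t; rewrite !ffunE scaler_sumr -big_split /=.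
by apply: eq_bigr => s _; rewrite !ffunE mulrDr scalerAr.
Qed.
HB.instance Definition _ j f :=
  GRing.isLinear.Build K (tens j) (tens j) *:%R (@extmap j f)
    (@extmap_is_linear j f).

Fact tact_is_linear j h : linear (@tact j h).
Proof. by move=> k x y; apply/ffunP=> t; rewrite !ffunE. Qed.
HB.instance Definition _ j h :=
  GRing.isLinear.Build K (tens j) (tens j) *:%R (@tact j h)
    (@tact_is_linear j h).

Fact gten_is_linear j g : linear (@gten j g).
Proof.
move=> k x y; apply/ffunP=> g'; rewrite !ffunE.
by case: ifP => _ //; rewrite scaler0 addr0.
Qed.
HB.instance Definition _ j g :=
  GRing.isLinear.Build K (tens j) (gtens j) *:%R (@gten j g)
    (@gten_is_linear j g).

Fact gact_is_linear j s : linear (@gact j s).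
Proof.
move=> k x y; rewrite /gact scaler_sumr -big_split /=.
by apply: eq_bigr => g _; rewrite !ffunE linearP.
Qed.
HB.instance Definition _ j s :=
  GRing.isLinear.Build K (gtens j) (gtens j) *:%R (@gact j s)
    (@gact_is_linear j s).

Fact gact_gten j s g (x : tens j) : gact s (gten g x) = gten (pcomp s g) x.
Proof.
rewrite /gact (bigD1 g) //= !ffunE eqxx big1 ?addr0 // => g' /negPf ng.
by rewrite ffunE ng linear0.
Qed.

Fact tact_wedge j h (w : 'I_j -> vec) :
  tact h (wedge w) = wedge (fun a => vact h (w a)).
Proof.
apply/ffunP=> t; rewrite !ffunE; congr (\det _).
by apply/matrixP=> a b; rewrite !mxE !ffunE.
Qed.

Fact extmap_wedge j (f : 'End(vec)) (w : 'I_j -> vec) :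
  extmap f (wedge w) = wedge (fun a => f (w a)).
Proof.
have fE (x : vec) t : f x t = \sum_v f (unitv v) t * x v.
  have Ex : x = \sum_v x v *: unitv v.
    apply/ffunP=> u; rewrite sum_ffunE (bigD1 u) //= big1 ?addr0.
      by rewrite !ffunE eqxx; symmetry; exact: mulr1.
    move=> v; rewrite eq_sym => /negPf uv.
    by rewrite !ffunE uv; exact: mulr0.
  rewrite {1}Ex linear_sum /= sum_ffunE; apply: eq_bigr => v _.
  by rewrite linearZ /= !ffunE; exact: mulrC.
apply/ffunP=> t; rewrite !ffunE.
under eq_bigr => s _ do rewrite ffunE -det_tr /determinant big_distrr /=.
rewrite exchange_big -det_tr /=; apply: eq_bigr => p _.
transitivity ((-1) ^+ p * \sum_(s : {ffun 'I_j -> V})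
    \prod_b (f (unitv (s b)) (t b) * w (p b) (s b))).
  rewrite big_distrr /=; apply: eq_bigr => s _.
  rewrite mulrCA big_split /=; congr (_ * (_ * _)).
  by apply: eq_bigr => b _; rewrite !mxE.
rewrite -(bigA_distr_bigA (fun b v => f (unitv v) (t b) * w (p b) v)) /=.
by congr (_ * _); apply: eq_bigr => b _; rewrite !mxE fE.
Qed.

Fact wedge_extpow j (W : {vspace vec}) (w : 'I_j -> vec) :
  (forall a, w a \in W) -> wedge w \in extpow j W.
Proof.
move=> wW; set d := \dim W.
pose c a i : K := coord (vbasis W) i (w a).
have -> : wedge w = \sum_(s : {ffun 'I_j -> 'I_d})
    (\prod_a c a (s a)) *: wedge (fun a => (vbasis W)`_(s a)).
  apply/ffunP=> t; rewrite sum_ffunE !ffunE /determinant.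
  under [RHS]eq_bigr => s _ do
    rewrite !ffunE /GRing.scale /= /determinant big_distrr /=.
  rewrite exchange_big /=; apply: eq_bigr => p _.
  transitivity ((-1) ^+ p * \prod_a
      \sum_(i < d) c a i * ((vbasis W)`_i (t (p a)) : K)).
    congr (_ * _); apply: eq_bigr => a _; rewrite mxE.
    rewrite {1}(coord_vbasis (wW a)) sum_ffunE.
    by apply: eq_bigr => i _; rewrite ffunE.
  rewrite bigA_distr_bigA big_distrr /=; apply: eq_bigr => s _.
  rewrite [RHS]mulrCA big_split /=; congr (_ * (_ * _)).
  by apply: eq_bigr => a _; rewrite mxE.
apply: memv_suml => s _; apply: memvZ; apply: memv_span.
by apply/imageP; exists s.
Qed.

Section Graph.
Variables (m : nat) (G : mgraph V m).
Implicit Types F : {set 'I_m}.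

Definition adj F : rel V := fun u v => [exists k in F, ends G k == [set u; v]].

Definition component F (v : V) : {set V} := [set u | connect (adj F) v u].

Definition same_components F F' := [forall v, component F v == component F' v].

(* S_F as an internal direct product. *)
Definition cgroup F : {set {perm V}} :=
  [set s : {perm V} | [forall v, s v \in component F v]].

Fact cgroup_group_set F : group_set (cgroup F).
Proof.
apply/group_setP; split=> [|s t]; rewrite !inE.
  by apply/forallP=> v; rewrite perm1 inE connect0.
move=> /forallP Hs /forallP Ht; apply/forallP=> v; rewrite permM inE.
have := Hs v; have := Ht (s v); rewrite !inE => Hst Hvs.
exact: connect_trans Hvs Hst.
Qed.
Canonical cgroup_group F := Group (cgroup_group_set F).

Definition csum F (v : V) (x : vec) : K^o := \sum_(u in component F v) x u.

Fact csum_is_linear F v : linear (csum F v).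
Proof.
move=> k x y; rewrite /csum scaler_sumr -big_split /=.
by apply: eq_bigr => u _; rewrite !ffunE.
Qed.
HB.instance Definition _ F v :=
  GRing.isLinear.Build K vec K^o *:%R (csum F v) (csum_is_linear F v).

Definition Wsp F : {vspace vec} := (\bigcap_v lker (linfun (csum F v)))%VS.

Fact WspP F (x : vec) :
  reflect (forall v, \sum_(u in component F v) x u = 0) (x \in Wsp F).
Proof.
rewrite /Wsp memvE; apply: (iffP subv_bigcapP) => [H v|H v _].
  by have := H v isT; rewrite -memvE memv_ker lfunE /= => /eqP.
by rewrite -memvE memv_ker lfunE /= /csum H.
Qed.

(* The orthogonal projection of K^V onto W_F, see [oproj_in] and
   [oproj_orth]. *)
Definition oproj_fun F (x : vec) : vec :=
  [ffun v => x v - (\sum_(u in component F v) x u) / #|component F v|%:R].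

Fact oproj_is_linear F : linear (oproj_fun F).
Proof.
move=> k x y; apply/ffunP=> v; rewrite !ffunE.
have := csum_is_linear F v k x y; rewrite /csum => ->.
set s := \sum_(u in _) _; set s' := \sum_(u in _) _; set c := _%:R.
by rewrite /GRing.scale /= mulrDl mulrBr !mulrA opprD addrACA.
Qed.
HB.instance Definition _ F :=
  GRing.isLinear.Build K vec vec *:%R (oproj_fun F) (oproj_is_linear F).

Definition oproj F : 'End(vec) := linfun (oproj_fun F).

Fact adj_sym F : symmetric (adj F).
Proof.
by move=> u v; apply: eq_existsb => k; rewrite setUC.
Qed.

Fact component_eq F u v : u \in component F v -> component F u = component F v.
Proof.
rewrite inE => vu; apply/setP=> w; rewrite !inE.
by rewrite (same_connect (sym_connect_sym (@adj_sym F)) vu).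
Qed.

Fact component_refl F v : v \in component F v.
Proof. by rewrite inE connect0. Qed.

Fact oproj_in F (x : vec) : oproj F x \in Wsp F.
Proof.
apply/WspP=> v; rewrite lfunE /=.
under eq_bigr => u uv do rewrite ffunE (component_eq uv).
rewrite sumrB sumr_const -[X in _ - X]mulr_natr divfK ?subrr //.
by rewrite pnatr_eq0 -lt0n; apply/card_gt0P; exists v; exact: component_refl.
Qed.

Fact oproj_orth F (x y : vec) :
  y \in Wsp F -> \sum_v (x v - oproj F x v) * (y v)^* = 0.
Proof.
move/WspP=> yW; rewrite (partition_big_imset (component F)) /=.
apply: big1 => B /imsetP[v _ ->].
have Ev u : (component F u == component F v) = (u \in component F v).
  apply/eqP/idP=> [<-|]; [exact: component_refl | exact: component_eq].
rewrite (eq_bigl _ _ Ev).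
under eq_bigr => u uv.
  rewrite lfunE /= ffunE subKr (component_eq uv); over.
by rewrite -mulr_sumr -rmorph_sum yW rmorph0 mulr0.
Qed.

(* K[S_V] (x)_K /\^j W_F *)
Definition ind_num j F : {vspace gtens j} :=
  (\sum_(g : {perm V}) linfun (@gten j g) @: extpow j (Wsp F))%VS.

(* gh (x) x - g (x) hx *)
Definition bal j (g h : {perm V}) (x : tens j) : gtens j :=
  gten (pcomp g h) x - gten g (tact h x).

Fact bal_is_linear j g h : linear (@bal j g h).
Proof.
by move=> k x y; rewrite /bal !linearP /= scalerDr addrACA.
Qed.
HB.instance Definition _ j g h :=
  GRing.isLinear.Build K (tens j) (gtens j) *:%R (@bal j g h)
    (@bal_is_linear j g h).

Definition ind_rel j F : {vspace gtens j} :=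
  (\sum_(g : {perm V}) \sum_(h in cgroup F)
     linfun (@bal j g h) @: extpow j (Wsp F))%VS.

(* The degree j part of M_F = K[S_V] (x)_(K[S_F]) /\^* W_F. *)
Definition Mmod j F : {vspace gtens j} := quotv (ind_num j F) (ind_rel j F).
Definition Mpi j F : 'End(gtens j) := quot_pi (ind_num j F) (ind_rel j F).

(* g (x) x |-> \sum_h gh (x) (/\^j pi)(h^-1 x), where h runs over
   representatives of S_F / S_F'. Because of [pcomp], the cosets h S_F' are
   right cosets for the library's product. *)
Definition dsplit j F F' (a : gtens j) : gtens j :=
  \sum_(g : {perm V}) \sum_(C in rcosets (cgroup F') (cgroup F))
    gten (pcomp g (repr C)) (extmap (oproj F') (tact (repr C)^-1%g (a g))).

Fact dsplit_is_linear j F F' : linear (@dsplit j F F').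
Proof.
move=> k x y; rewrite /dsplit scaler_sumr -big_split /=.
apply: eq_bigr => g _; rewrite scaler_sumr -big_split /=.
by apply: eq_bigr => C _; rewrite !ffunE !linearP.
Qed.
HB.instance Definition _ j F F' :=
  GRing.isLinear.Build K (gtens j) (gtens j) *:%R (@dsplit j F F')
    (@dsplit_is_linear j F F').

Definition dedge j F F' (a : gtens j) : gtens j :=
  Mpi j F' (if same_components F F' then a else dsplit F F' a).

Fact dedge_is_linear j F F' : linear (@dedge j F F').
Proof. by move=> k x y; rewrite /dedge; case: ifP => _; rewrite !linearP. Qed.
HB.instance Definition _ j F F' :=
  GRing.isLinear.Build K (gtens j) (gtens j) *:%R (@dedge j F F')
    (@dedge_is_linear j F F').

Local Notation chain j := {ffun {set 'I_m} -> gtens j}.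

Definition cinj j F (a : gtens j) : chain j :=
  [ffun F' => if F' == F then a else 0].

Fact cinj_is_linear j F : linear (@cinj j F).
Proof.
move=> k x y; apply/ffunP=> F'; rewrite !ffunE.
by case: ifP => _ //; rewrite scaler0 addr0.
Qed.
HB.instance Definition _ j F :=
  GRing.isLinear.Build K (gtens j) (chain j) *:%R (@cinj j F)
    (@cinj_is_linear j F).

Definition Csp i j : {vspace chain j} :=
  (\sum_(F : {set 'I_m} | #|F| == i) linfun (@cinj j F) @: Mmod j F)%VS.

Definition ones_after F (k : 'I_m) : nat := #|[set l in F | (k < l)%N]|.

Definition cdiff_fun j (c : chain j) : chain j :=
  \sum_(F : {set 'I_m}) \sum_(k in F)
    (-1) ^+ ones_after F k *: cinj (F :\ k) (dedge F (F :\ k) (c F)).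

Fact cdiff_is_linear j : linear (@cdiff_fun j).
Proof.
move=> a x y; rewrite /cdiff_fun scaler_sumr -big_split /=.
apply: eq_bigr => F _; rewrite scaler_sumr -big_split /=.
by apply: eq_bigr => k _; rewrite !ffunE !linearP.
Qed.
HB.instance Definition _ j :=
  GRing.isLinear.Build K (chain j) (chain j) *:%R (@cdiff_fun j)
    (@cdiff_is_linear j).

(* Its restriction to [Csp i j] is d_(i, j). *)
Definition cdiff j : 'End(chain j) := linfun (@cdiff_fun j).

Definition cact_fun j (s : {perm V}) (c : chain j) : chain j :=
  [ffun F => Mpi j F (gact s (c F))].

Fact cact_is_linear j s : linear (@cact_fun j s).
Proof. by move=> a x y; apply/ffunP=> F; rewrite !ffunE !linearP. Qed.
HB.instance Definition _ j s :=
  GRing.isLinear.Build K (chain j) (chain j) *:%R (@cact_fun j s)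
    (@cact_is_linear j s).

Definition cact j (s : {perm V}) : 'End(chain j) := linfun (@cact_fun j s).

Definition cycles i j : {vspace chain j} := (Csp i j :&: lker (cdiff j))%VS.
Definition boundaries i j : {vspace chain j} := (cdiff j @: Csp i.+1 j)%VS.

Definition Hsp i j : {vspace chain j} := quotv (cycles i j) (boundaries i j).

Definition hact i j (s : {perm V}) : 'End(chain j) :=
  (quot_pi (cycles i j) (boundaries i j) \o cact j s)%VF.

End Graph.

(* Isomorphism of the S_V-modules U and U', whose actions are the restrictions
   of a and a'. *)
Definition smod_iso (E E' : vectType K)
    (U : {vspace E}) (a : {perm V} -> 'End(E))
    (U' : {vspace E'}) (a' : {perm V} -> 'End(E')) : Prop :=
  exists f : 'Hom(E, E'),
    [/\ (f @: U)%VS = U',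
        (U :&: lker f)%VS = 0%VS &
        forall s x, x \in U -> f (a s x) = a' s (f x)].

(* Isomorphism of bigraded S_V-modules. *)
Definition homology_iso m (G : mgraph V m) m' (G' : mgraph V m') : Prop :=
  forall i j, smod_iso (Hsp G i j) (@hact m G i j) (Hsp G' i j) (@hact m' G' i j).

End ChromaticHomology.

Arguments homology_iso K {V m} G {m'} G'.

(* Main.v *)
From HB Require Import structures.
Require Import Defs.
From mathcomp Require Import all_boot all_order all_algebra all_fingroup.
From mathcomp Require Import boolp reals complex.
From mathcomp Require Import ring.
Set Implicit Arguments.
Unset Strict Implicit.
Unset Printing Implicit Defensive.
Import Defs GRing.Theory Num.Theory.
Local Open Scope ring_scope.
Local Open Scope complex_scope.

(* Let C' be the span in C(G) of the states without e': it is a subcomplex,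
   isomorphic to C(G - e'). On the remaining states, deleting e does not change
   the components, so C(G) / C' is the cone of an isomorphism and C' has the
   same homology as C(G). All the squares of C(G) needed to make this explicit
   contain a deletion of e or e' that is an identity, so they commute because
   d_epsilon depends on the components only; in particular d^2 = 0 is never
   used in general. *)

(** * Subquotients A/B, where B need not lie in A *)

Section Subquotients.
Variables (K : fieldType) (E : vectType K).
Implicit Types (A B : {vspace E}) (z : E).

Lemma quot_pi_in A B z : quot_pi A B z \in quotv A B.
Proof. exact: memv_pi. Qed.

Lemma quotv_sub A B z : z \in quotv A B -> z \in A.
Proof. exact: (subvP (diffvSl A B)). Qed.

Lemma quotv_pi_id A B z : z \in quotv A B -> quot_pi A B z = z.
Proof. by move=> zAB; rewrite /quot_pi /addv_pi1 daddv_pi_id ?capv_diff. Qed.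

(** The relations are taken in [A :&: B]: with cycles for A and boundaries for B, an inclusion of B
    in A would amount to d^2 = 0, which the proof avoids. *)
Lemma quot_pi_subr A B z : z \in A -> z - quot_pi A B z \in (A :&: B)%VS.
Proof.
move=> zA; have pA := quotv_sub (quot_pi_in A B z).
have dA : z - quot_pi A B z \in A by rewrite rpredB.
rewrite memv_cap dA /= -(quot_pi_eq0 B dA) linearB /=.
by rewrite (quotv_pi_id (quot_pi_in A B z)) subrr.
Qed.

Lemma quot_pi0 A B z : z \in (A :&: B)%VS -> quot_pi A B z = 0.
Proof. by rewrite memv_cap => /andP[zA zB]; apply/eqP; rewrite quot_pi_eq0. Qed.

Lemma quot_pi_eq A B z z' :
  z - z' \in (A :&: B)%VS -> quot_pi A B z = quot_pi A B z'.
Proof. by move/quot_pi0/eqP; rewrite linearB /= subr_eq0 => /eqP. Qed.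

End Subquotients.

(** * Isomorphisms of modules and of subquotients *)

Section Isomorphisms.
Variables (K : numClosedFieldType) (V : finType) (E E' : vectType K).

(** The inclusion of C' induces a map from the homology of G - e' to that of G, opposite to the
    direction of the theorem. Stability of U makes the inverse equivariant. *)
Lemma smod_iso_sym (U : {vspace E}) (a : {perm V} -> 'End(E))
    (U' : {vspace E'}) (a' : {perm V} -> 'End(E')) :
  (forall s z, z \in U -> a s z \in U) -> smod_iso U a U' a' ->
  smod_iso U' a' U a.
Proof.
move=> aU [f [fU kerf fa]].
(* The inner inverse is a section over U', but its values may leave U; the outer [projv U] brings
   them back without changing their image. *)
pose g : 'Hom(E', E) := (projv U \o (f \o projv U)^-1)%VF.
have limf : limg (f \o projv U)%VF = U' by rewrite limg_comp limg_proj fU.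
have gK z' : z' \in U' -> f (g z') = z'.
  by rewrite -limf => /limg_lfunVK; rewrite comp_lfunE [g z']comp_lfunE.
have gU z' : g z' \in U by rewrite comp_lfunE memv_proj.
have finj z : z \in U -> f z = 0 -> z = 0.
  move=> zU fz0; apply/eqP; rewrite -memv0 -kerf memv_cap zU memv_ker.
  exact/eqP.
have fgK z : z \in U -> g (f z) = z.
  move=> zU; apply/eqP; rewrite -subr_eq0; apply/eqP/finj; first by rewrite rpredB.
  by rewrite linearB /= gK ?subrr // -fU memv_img.
exists g; split.
- apply/eqP; rewrite eqEsubv; apply/andP; split; apply/subvP=> z.
    by case/memv_imgP=> z' _ ->.
  by move=> zU; rewrite -(fgK z zU) memv_img // -fU memv_img.
- apply/eqP; rewrite -subv0; apply/subvP=> z'; rewrite memv_cap memv_ker.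
  by case/andP=> zU /eqP gz; rewrite memv0 -(gK _ zU) gz linear0.
- move=> s z' zU; have az : a s (g z') \in U by exact: aU.
  by rewrite -{1}(gK z' zU) -(fa s (g z') (gU z')) fgK.
Qed.

(** A test on representatives: the hypotheses relating B and B' make the induced map well defined
    and injective, and the existence of [z'] makes it onto. *)
Lemma smod_iso_quotv (A B : {vspace E}) (a : {perm V} -> 'End(E))
    (A' B' : {vspace E'}) (a' : {perm V} -> 'End(E')) (f : 'Hom(E', E)) :
  (forall s z, z \in A -> a s z \in A) ->
  (forall s z, z \in (A :&: B)%VS -> a s z \in (A :&: B)%VS) ->
  (forall s z, z \in A' -> a' s z \in A') ->
  (forall z, z \in A' -> f z \in A) ->
  (forall z, z \in (A' :&: B')%VS -> f z \in B) ->
  (forall z, z \in A' -> f z \in B -> z \in B') ->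
  (forall z, z \in A -> exists2 z', z' \in A' & z - f z' \in B) ->
  (forall s z, z \in A' -> f (a' s z) = a s (f z)) ->
  smod_iso (quotv A' B') (fun s => quot_pi A' B' \o a' s)%VF
           (quotv A B) (fun s => quot_pi A B \o a s)%VF.
Proof.
move=> aA aB aA' fA fB fB' fsurj fa.
have fAB z : z \in (A' :&: B')%VS -> f z \in (A :&: B)%VS.
  by move=> zAB; rewrite memv_cap fB // fA //; case/memv_capP: zAB.
have fpi z : z \in A' -> quot_pi A B (f (quot_pi A' B' z)) = quot_pi A B (f z).
  move=> zA; apply: esym; apply: quot_pi_eq; rewrite -linearB /=.
  by apply: fAB; exact: quot_pi_subr.
exists (quot_pi A B \o f)%VF; split.
- apply/eqP; rewrite eqEsubv; apply/andP; split; apply/subvP=> z.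
    by case/memv_imgP=> z' _ ->; rewrite comp_lfunE quot_pi_in.
  move=> zQ; have zA := quotv_sub zQ; have [z' zA' zB] := fsurj z zA.
  apply/memv_imgP; exists (quot_pi A' B' z'); first exact: quot_pi_in.
  rewrite comp_lfunE fpi // -{1}(quotv_pi_id zQ); apply: quot_pi_eq.
  by rewrite memv_cap zB rpredB // fA.
- apply/eqP; rewrite -subv0; apply/subvP=> z; rewrite memv_cap memv_ker.
  case/andP=> zQ; have zA := quotv_sub zQ.
  rewrite comp_lfunE /= quot_pi_eq0 ?fA // => /(fB' _ zA) zB.
  by rewrite -(quotv_pi_id zQ) quot_pi0 ?mem0v // memv_cap zA.
- move=> s z /quotv_sub zA; rewrite !comp_lfunE /= fpi ?aA' // fa //.
  apply: quot_pi_eq; rewrite -linearB /=; apply: aB; apply: quot_pi_subr.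
  exact: fA.
Qed.

End Isomorphisms.

(** * Exterior powers, induced modules and per-edge maps *)

Section InducedModules.
Variables (K : numClosedFieldType) (V : finType).
Local Notation vec := {ffun V -> K^o}.
Local Notation tens j := {ffun {ffun 'I_j -> V} -> K^o}.
Local Notation gtens j := {ffun {perm V} -> tens j}.

(** The preimage of U is a subspace, so it is enough that it contains the spanning wedges. Allowing
    every wedge of vectors of W hides the chosen basis from later proofs. *)
Lemma extpow_ind j (W : {vspace vec}) (U : {vspace tens j})
    (f : {linear tens j -> tens j}) :
  (forall w, (forall a, w a \in W) -> f (wedge w) \in U) ->
  forall t, t \in extpow j W -> f t \in U.
Proof.
move=> fU t tW; rewrite -[f t]lfunE memv_preim; apply: subvP t tW.
apply/span_subvP=> _ /imageP[s _ ->]; rewrite -memv_preim lfunE.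
by apply: fU => a; apply: vbasis_mem; rewrite mem_nth // size_tuple.
Qed.

Lemma extpow_eq j (W : {vspace vec}) (f g : {linear tens j -> tens j}) :
  (forall w, (forall a, w a \in W) -> f (wedge w) = g (wedge w)) ->
  forall t, t \in extpow j W -> f t = g t.
Proof.
move=> fg t tW; apply/eqP; rewrite -subr_eq0 -memv0; move: t tW.
apply: (extpow_ind (f := f \- g)) => w wW.
by rewrite /= fg // subrr mem0v.
Qed.

Lemma tactM j (g h : {perm V}) (t : tens j) :
  tact (pcomp g h) t = tact g (tact h t).
Proof.
apply/ffunP=> u; rewrite !ffunE; congr (t _); apply/ffunP=> b.
by rewrite !ffunE /pcomp invMg permM.
Qed.

Lemma tact1 j (t : tens j) : tact 1%g t = t.
Proof.
apply/ffunP=> u; rewrite !ffunE; congr (t _); apply/ffunP=> b.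
by rewrite ffunE invg1 perm1.
Qed.

Lemma gtens_eq j (f g : {linear gtens j -> gtens j}) :
  (forall p t, f (gten p t) = g (gten p t)) -> f =1 g.
Proof.
move=> fg a; have -> : a = \sum_p gten p (a p).
  apply/ffunP=> p; rewrite sum_ffunE (bigD1 p) //= big1 ?addr0 ?ffunE ?eqxx //.
  by move=> p' /negPf pp'; rewrite ffunE eq_sym pp'.
by rewrite !linear_sum; apply: eq_bigr => p _; exact: fg.
Qed.

Section SingleGraph.
Variables (m : nat) (G : mgraph V m).
Implicit Types F : {set 'I_m}.

Lemma cgroup_component F (h : {perm V}) v :
  h \in cgroup G F -> component G F (h v) = component G F v.
Proof. by rewrite inE => /forallP/(_ v)/component_eq. Qed.

Lemma cgroup_component_perm F (h : {perm V}) u v :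
  h \in cgroup G F -> (h u \in component G F v) = (u \in component G F v).
Proof.
move=> hF; apply/idP/idP=> uv.
  by rewrite -(component_eq uv) cgroup_component // component_refl.
by rewrite -(component_eq uv) -(cgroup_component u hF) component_refl.
Qed.

Lemma sum_component_vact F (h : {perm V}) (w : vec) v :
  h \in cgroup G F ->
  \sum_(u in component G F v) vact h w u = \sum_(u in component G F v) w u.
Proof.
move=> hF; rewrite (reindex_inj (@perm_inj _ h)) /=.
by apply: eq_big => u; [exact: cgroup_component_perm | rewrite ffunE permK].
Qed.

Lemma vact_Wsp F h (w : vec) :
  h \in cgroup G F -> w \in Wsp K G F -> vact h w \in Wsp K G F.
Proof.
by move=> hF /WspP wW; apply/WspP=> v; rewrite sum_component_vact.
Qed.

Lemma oproj_vact F h (w : vec) :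
  h \in cgroup G F -> oproj K G F (vact h w) = vact h (oproj K G F w).
Proof.
move=> hF; apply/ffunP=> v; rewrite !lfunE /= !ffunE sum_component_vact //.
by rewrite (cgroup_component v (groupVr hF)).
Qed.

Lemma tact_extpow j F h (t : tens j) :
  h \in cgroup G F -> t \in extpow j (Wsp K G F) ->
  tact h t \in extpow j (Wsp K G F).
Proof.
move=> hF; apply: (extpow_ind (f := @tact K V j h)) => w wW.
by rewrite /= tact_wedge; apply: wedge_extpow => a; exact: vact_Wsp.
Qed.

Lemma extmap_extpow j W F (t : tens j) :
  t \in extpow j W -> extmap (oproj K G F) t \in extpow j (Wsp K G F).
Proof.
apply: (extpow_ind (f := @extmap K V j (oproj K G F))) => w _.
by rewrite /= extmap_wedge; apply: wedge_extpow => a; exact: oproj_in.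
Qed.

Lemma extmap_tact j W F h (t : tens j) :
  h \in cgroup G F -> t \in extpow j W ->
  extmap (oproj K G F) (tact h t) = tact h (extmap (oproj K G F) t).
Proof.
move=> hF; apply: (extpow_eq (f := @extmap K V j (oproj K G F) \o @tact K V j h)
                              (g := @tact K V j h \o @extmap K V j (oproj K G F))).
move=> w _ /=; rewrite tact_wedge !extmap_wedge tact_wedge.
by congr wedge; apply: funext => a; rewrite oproj_vact.
Qed.

Lemma gten_num j F g (t : tens j) :
  t \in extpow j (Wsp K G F) -> gten g t \in ind_num K G j F.
Proof.
move=> tW; apply: (subvP (sumv_sup g isT (subvv _))).
by apply/memv_imgP; exists t; rewrite ?lfunE.
Qed.

Lemma bal_rel j F g h (t : tens j) :
  h \in cgroup G F -> t \in extpow j (Wsp K G F) ->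
  bal g h t \in ind_rel K G j F.
Proof.
move=> hF tW; apply: (subvP (sumv_sup g isT (subvv _))).
apply: (subvP (sumv_sup h hF (subvv _))).
by apply/memv_imgP; exists t; rewrite ?lfunE.
Qed.

Lemma ind_num_ind j F (U : {vspace gtens j}) (f : {linear gtens j -> gtens j}) :
  (forall g t, t \in extpow j (Wsp K G F) -> f (gten g t) \in U) ->
  forall a, a \in ind_num K G j F -> f a \in U.
Proof.
move=> fU a aF; rewrite -[f a]lfunE memv_preim; apply: subvP a aF.
apply/subv_sumP=> g _; apply/subvP=> _ /memv_imgP[t tW ->].
by rewrite -memv_preim !lfunE; exact: fU.
Qed.

Lemma ind_rel_ind j F (U : {vspace gtens j}) (f : {linear gtens j -> gtens j}) :
  (forall g h t, h \in cgroup G F -> t \in extpow j (Wsp K G F) ->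
     f (bal g h t) \in U) ->
  forall a, a \in ind_rel K G j F -> f a \in U.
Proof.
move=> fU a aF; rewrite -[f a]lfunE memv_preim; apply: subvP a aF.
apply/subv_sumP=> g _; apply/subv_sumP=> h hF.
apply/subvP=> _ /memv_imgP[t tW ->].
by rewrite -memv_preim !lfunE; exact: fU.
Qed.

Lemma ind_rel_num j F a : a \in ind_rel K G j F -> a \in ind_num K G j F.
Proof.
apply: (ind_rel_ind (f := idfun)) => g h t hF tW /=.
by rewrite rpredB // gten_num // tact_extpow.
Qed.

Lemma gact_num j F s a :
  a \in ind_num K G j F -> gact s a \in ind_num K G j F.
Proof.
apply: (ind_num_ind (f := @gact K V j s)) => g t tW.
by rewrite /= gact_gten gten_num.
Qed.

(** Left multiplication by s commutes with right multiplication by h, so s sends the relation of g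
    and h to the relation of sg and h. *)
Lemma gact_rel j F s a :
  a \in ind_rel K G j F -> gact s a \in ind_rel K G j F.
Proof.
apply: (ind_rel_ind (f := @gact K V j s)) => g h t hF tW.
by rewrite linearB /= !gact_gten /pcomp -mulgA; exact: bal_rel.
Qed.

Lemma dsplit_gten j F F' g (t : tens j) :
  dsplit G F F' (gten g t) = \sum_(C in rcosets (cgroup G F') (cgroup G F))
    gten (pcomp g (repr C)) (extmap (oproj K G F') (tact (repr C)^-1%g t)).
Proof.
rewrite /dsplit (bigD1 g) //= [X in _ + X]big1 ?addr0.
  by apply: eq_bigr => C _; rewrite ffunE eqxx.
move=> g' /negPf gg'; apply: big1 => C _.
by rewrite ffunE gg' !linear0.
Qed.

Lemma gact_dsplit j F F' s (a : gtens j) :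
  gact s (dsplit G F F' a) = dsplit G F F' (gact s a).
Proof.
move: a; apply: (gtens_eq (f := @gact K V j s \o @dsplit K V m G j F F')
                         (g := @dsplit K V m G j F F' \o @gact K V j s)) => g t.
rewrite /= gact_gten !dsplit_gten linear_sum; apply: eq_bigr => C _.
by rewrite /= gact_gten /pcomp mulgA.
Qed.

Lemma mem_repr_rcosets F F' C :
  cgroup G F' \subset cgroup G F ->
  C \in rcosets (cgroup G F') (cgroup G F) -> repr C \in cgroup G F.
Proof.
move=> sF /rcosetsP[h hF ->]; have [k kF'] := repr_rcosetP (cgroup_group G F') h.
by apply: groupM => //; exact: (subsetP sF).
Qed.

Lemma dsplit_num j F F' a :
  cgroup G F' \subset cgroup G F ->
  a \in ind_num K G j F -> dsplit G F F' a \in ind_num K G j F'.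
Proof.
move=> sF; apply: (ind_num_ind (f := @dsplit K V m G j F F')) => g t tW.
rewrite /= dsplit_gten; apply: memv_suml => C CF.
apply/gten_num/(extmap_extpow (W := Wsp K G F)).
by apply: tact_extpow => //; rewrite groupV (mem_repr_rcosets sF).
Qed.

(* In function notation h repr(C) lies in the coset h C, so it equals
   repr(h C) k with k in S_F'; the two corresponding terms then differ by a
   relation. *)
Lemma dsplit_rel j F F' a :
  cgroup G F' \subset cgroup G F ->
  a \in ind_rel K G j F -> dsplit G F F' a \in ind_rel K G j F'.
Proof.
move=> sF; apply: (ind_rel_ind (f := @dsplit K V m G j F F')) => g h t hF tW.
rewrite linearB /= !dsplit_gten.
(* As h lies in S_F, multiplication by h permutes the cosets of S_F' in S_F; after this reindexing
   the two sums are compared term by term. *)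
rewrite [X in _ - X](reindex_onto (fun C => C :* h)%g (fun C => C :* h^-1)%g) /=;
  last by move=> C _; rewrite -rcosetM mulVg rcoset1.
rewrite [X in _ - X](eq_bigl (mem (rcosets (cgroup G F') (cgroup G F)))); last first.
  move=> C; rewrite -rcosetM mulgV rcoset1 eqxx andbT.
  apply/rcosetsP/rcosetsP=> -[k kF].
    move/(congr1 (fun D => D :* h^-1)%g); rewrite -!rcosetM mulgV rcoset1 => ->.
    by exists (k * h^-1)%g; rewrite // groupM ?groupV.
  by move=> ->; exists (k * h)%g; rewrite ?groupM // rcosetM.
rewrite -sumrB; apply: memv_suml => C CF.
have rC := mem_repr_rcosets sF CF.
have [k kF' Ek] : exists2 k,
    k \in cgroup G F' & repr (C :* h)%g = (k * (repr C * h))%g.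
  case/rcosetsP: CF => c cF EC.
  rewrite EC -rcosetM.
  have [k2 k2F'] := repr_rcosetP (cgroup_group G F') (c * h)%g.
  have [k1 k1F'] := repr_rcosetP (cgroup_group G F') c.
  by exists (k2 * k1^-1)%g; rewrite ?groupM ?groupV // !mulgA mulgKV.
pose t' := extmap (oproj K G F') (tact (repr C)^-1%g t).
have t'W : t' \in extpow j (Wsp K G F').
  apply: (extmap_extpow (W := Wsp K G F)); apply: tact_extpow => //.
  by rewrite groupV.
pose g' := pcomp (pcomp g h) (repr C).
have -> : tact (repr (C :* h)%g)^-1%g (tact h t)
    = tact k^-1%g (tact (repr C)^-1%g t).
  rewrite -!tactM; congr tact; rewrite Ek /pcomp !invMg.
  by rewrite !mulgA mulgV mul1g.
rewrite (extmap_tact (W := Wsp K G F) (h := k^-1%g)) ?groupV //; last first.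
  by apply: tact_extpow => //; rewrite groupV.
rewrite -/t' -/g'.
have -> : pcomp g (repr (C :* h)%g) = pcomp g' k by rewrite Ek /g' /pcomp !mulgA.
rewrite -opprB rpredN.
(* In this form the difference is [bal g' k] applied to [tact k^-1 t']. *)
have -> : gten g' t' = gten g' (tact k (tact k^-1%g t')).
  by rewrite -tactM /pcomp mulVg tact1.
by apply: bal_rel => //; apply: tact_extpow; rewrite ?groupV.
Qed.

Lemma Mmod_num j F a : a \in Mmod K G j F -> a \in ind_num K G j F.
Proof. exact: quotv_sub. Qed.

Lemma Mpi_in j F a : Mpi K G j F a \in Mmod K G j F.
Proof. exact: quot_pi_in. Qed.

Lemma Mpi_id j F a : a \in Mmod K G j F -> Mpi K G j F a = a.
Proof. exact: quotv_pi_id. Qed.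

Lemma Mpi_rel j F a b :
  a - b \in ind_rel K G j F -> Mpi K G j F a = Mpi K G j F b.
Proof.
by move=> ab; apply: quot_pi_eq; rewrite memv_cap ab andbT ind_rel_num.
Qed.

Lemma Mpi_subr j F a :
  a \in ind_num K G j F -> a - Mpi K G j F a \in ind_rel K G j F.
Proof. by move=> aF; case/memv_capP: (quot_pi_subr (ind_rel K G j F) aF). Qed.

Lemma dedge_in j F F' a : dedge G F F' a \in Mmod K G j F'.
Proof. exact: Mpi_in. Qed.

End SingleGraph.

(** * Dependence on the components only *)

Section TwoGraphs.
Variables (m m' : nat) (G : mgraph V m) (G' : mgraph V m').

(** Adjacency only asks whether a pair is the end set of some chosen edge, so multiplicities and the
    enumeration are invisible. This serves both for parallel edges in G and for the passage from G
    to G - e'. *)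
Lemma component_imset (F : {set 'I_m}) (F' : {set 'I_m'}) :
  ends G @: F = ends G' @: F' -> component G F = component G' F'.
Proof.
move=> EF; apply: funext => v; apply/setP=> u; rewrite !inE.
have adjE n (H : mgraph V n) (S : {set 'I_n}) a b :
    adj H S a b = ([set a; b] \in ends H @: S).
  apply/existsP/imsetP=> -[k]; first by case/andP=> kS /eqP; exists k.
  by move=> kS Ek; exists k; rewrite kS Ek eqxx.
by apply: eq_connect => a b; rewrite !adjE EF.
Qed.

Section SameComponents.
Variables (F : {set 'I_m}) (F' : {set 'I_m'}).
Hypothesis EF : component G F = component G' F'.

Lemma cgroup_ext : cgroup G F = cgroup G' F'.
Proof. by rewrite /cgroup EF. Qed.

Lemma Wsp_ext : Wsp K G F = Wsp K G' F'.
Proof.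
apply/eqP; rewrite eqEsubv.
apply/andP; split; apply/subvP=> w /WspP Hw; apply/WspP=> v.
  by rewrite -EF.
by rewrite EF.
Qed.

Lemma ind_num_ext j : ind_num K G j F = ind_num K G' j F'.
Proof. by rewrite /ind_num Wsp_ext. Qed.

Lemma ind_rel_ext j : ind_rel K G j F = ind_rel K G' j F'.
Proof. by rewrite /ind_rel Wsp_ext cgroup_ext. Qed.

Lemma Mmod_ext j : Mmod K G j F = Mmod K G' j F'.
Proof. by rewrite /Mmod ind_num_ext ind_rel_ext. Qed.

Lemma Mpi_ext j : Mpi K G j F = Mpi K G' j F'.
Proof. by rewrite /Mpi ind_num_ext ind_rel_ext. Qed.

Lemma oproj_ext : oproj K G F = oproj K G' F'.
Proof.
by apply/lfunP=> w; rewrite !lfunE; apply/ffunP=> v; rewrite !ffunE EF.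
Qed.

End SameComponents.

(** Equal components give literally equal groups, subspaces and projections, hence the same cosets
    and representatives. The commutations of squares used later all come from this. *)
Lemma dedge_ext j (F1 F2 : {set 'I_m}) (F1' F2' : {set 'I_m'}) (a : gtens j) :
  component G F1 = component G' F1' -> component G F2 = component G' F2' ->
  dedge G F1 F2 a = dedge G' F1' F2' a.
Proof.
move=> E1 E2; rewrite /dedge (Mpi_ext E2) /same_components E1 E2.
by rewrite /dsplit (cgroup_ext E1) (cgroup_ext E2) (oproj_ext E2).
Qed.

End TwoGraphs.

(** * Identity maps and equivariance *)

Section Functoriality.
Variables (m : nat) (G : mgraph V m).
Implicit Types F : {set 'I_m}.

Lemma dedge_id j F F' (a : gtens j) :
  component G F = component G F' -> a \in Mmod K G j F -> dedge G F F' a = a.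
Proof.
move=> EF; rewrite (Mmod_ext EF) /dedge => aF.
have -> : same_components G F F' by apply/forallP=> v; rewrite EF.
exact: Mpi_id.
Qed.

Lemma component_sub F F' v :
  F' \subset F -> component G F' v \subset component G F v.
Proof.
move=> sF; apply/subsetP=> u; rewrite !inE; apply: connect_sub => a b.
case/existsP=> k /andP[kF Ek]; apply: connect1; apply/existsP; exists k.
by rewrite (subsetP sF).
Qed.

Lemma cgroup_sub F F' : F' \subset F -> cgroup G F' \subset cgroup G F.
Proof.
move=> sF; apply/subsetP=> h; rewrite !inE => /forallP hF.
by apply/forallP=> v; rewrite (subsetP (component_sub v sF)).
Qed.

(** The action may leave the complement that represents the quotient, whence the [Mpi]. Each such
    correction is a relation, and [dsplit] and [gact] preserve relations. *)
Lemma dedge_gact j F F' s a :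
  F' \subset F -> a \in Mmod K G j F ->
  dedge G F F' (Mpi K G j F (gact s a))
    = Mpi K G j F' (gact s (dedge G F F' a)).
Proof.
move=> sF aF; have sG := cgroup_sub sF; have aN := Mmod_num aF.
have saN := gact_num s aN; rewrite /dedge.
case: ifP => [/forallP FF'|_].
  have EF : component G F = component G F' by apply: funext => v; apply/eqP.
  rewrite -(Mpi_ext EF) (Mpi_id (Mpi_in _ _ _)); congr (Mpi K G j F (gact s _)).
  by rewrite Mpi_id.
transitivity (Mpi K G j F' (dsplit G F F' (gact s a))).
  apply: Mpi_rel; rewrite -linearB /= -opprB linearN /= rpredN.
  by apply: dsplit_rel => //; exact: Mpi_subr.
rewrite -gact_dsplit; apply: Mpi_rel; rewrite -linearB /=; apply: gact_rel.
by apply: Mpi_subr; exact: dsplit_num.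
Qed.

End Functoriality.
End InducedModules.

(** * The chain complex and its differential *)

Section Chains.
Variables (K : numClosedFieldType) (V : finType).
Local Notation tens j := {ffun {ffun 'I_j -> V} -> K^o}.
Local Notation gtens j := {ffun {perm V} -> tens j}.
Local Notation chain m j := {ffun {set 'I_m} -> gtens j}.

Section Differential.
Variables (m : nat) (G : mgraph V m) (j : nat).
Implicit Types (F : {set 'I_m}) (c : chain m j).

(** Only positions strictly after k count, so the sign is the same for F and [k |: F]; below it is
    mostly read at the smaller state. *)
Definition esign F k : K := (-1) ^+ ones_after F k.

Lemma esignU F k l : l \notin F ->
  esign (l |: F) k = (-1) ^+ (k < l)%N * esign F k.
Proof.
move=> lF; rewrite /esign -exprD; congr (_ ^+ _); rewrite /ones_after.
rewrite (cardsD1 l) !inE eqxx /=; congr (_ + _)%N; apply: eq_card => n.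
by rewrite !inE; case: eqVneq => [->|] //=; rewrite (negPf lF).
Qed.

Lemma esign_sqr F k : esign F k * esign F k = 1.
Proof. by rewrite /esign -expr2 sqrr_sign. Qed.

Lemma CspP i c :
  reflect (forall F : {set 'I_m}, c F \in if #|F| == i then Mmod K G j F else 0%VS)
          (c \in Csp K G i j).
Proof.
apply: (iffP memv_sumP) => [[b bP ->] F | cP].
  rewrite sum_ffunE; apply: memv_suml => F' F'i.
  have /memv_imgP[a aM ->] := bP F' F'i; rewrite lfunE /= ffunE.
  by case: eqVneq => [->|_]; rewrite ?F'i ?mem0v.
exists (fun F => cinj F (c F)) => [F Fi|].
  apply/memv_imgP; exists (c F); last by rewrite lfunE.
  by have := cP F; rewrite Fi.
apply/ffunP=> F; rewrite sum_ffunE big_mkcond (bigD1 F) //= ffunE eqxx.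
rewrite big1 ?addr0 => [|F' /negPf FF']; last first.
  by case: ifP => // _; rewrite ffunE eq_sym FF'.
by have := cP F; case: ifP => // _; rewrite memv0 => /eqP.
Qed.

Lemma Csp_Mmod i c F : c \in Csp K G i j -> c F \in Mmod K G j F.
Proof.
by move/CspP/(_ F); case: ifP => // _; rewrite memv0 => /eqP->; exact: mem0v.
Qed.

(** The differential is defined by its sources; this reads it at a target F, which is reached
    exactly from the states [k |: F] with k outside F. *)
Lemma cdiffE c F : cdiff K G j c F =
  \sum_(k | k \notin F) esign F k *: dedge G (k |: F) F (c (k |: F)).
Proof.
rewrite lfunE /= /cdiff_fun sum_ffunE.
rewrite (eq_bigr (fun F' : {set 'I_m} => \sum_(k in F')
  ((-1) ^+ ones_after F' k *: cinj (F' :\ k) (dedge G F' (F' :\ k) (c F'))) F));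
  last by move=> F' _; rewrite sum_ffunE.
rewrite (exchange_big_dep xpredT) //= [RHS]big_mkcond /=.
apply: eq_bigr => k _; case: ifPn => kF.
  rewrite (bigD1 (k |: F)) ?setU11 //= big1 ?addr0.
    by rewrite !ffunE setU1K // eqxx -/(esign _ _) esignU // ltnn mul1r.
  move=> F' /andP[kF' FF']; rewrite !ffunE; case: eqP => [EF|]; last first.
    by rewrite scaler0.
  by rewrite EF setD1K ?eqxx in FF'.
apply: big1 => F' kF'; rewrite !ffunE; case: eqP => [EF|]; last first.
  by rewrite scaler0.
by rewrite EF !inE eqxx in kF.
Qed.

Lemma cdiff_Csp i c : c \in Csp K G i.+1 j -> cdiff K G j c \in Csp K G i j.
Proof.
move=> /CspP cP; apply/CspP=> F; rewrite cdiffE; apply: memv_suml => k kF.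
apply: memvZ; case: ifP => [_|Fi]; first exact: dedge_in.
have := cP (k |: F); rewrite cardsU1 kF add1n eqSS Fi memv0 => /eqP->.
by rewrite linear0 mem0v.
Qed.

Lemma cactE s c F : cact K G j s c F = Mpi K G j F (gact s (c F)).
Proof. by rewrite lfunE ffunE. Qed.

Lemma cact_Csp i s c : c \in Csp K G i j -> cact K G j s c \in Csp K G i j.
Proof.
move=> /CspP cP; apply/CspP=> F; rewrite cactE.
have := cP F; case: ifP => _; first by rewrite Mpi_in.
by rewrite !memv0 => /eqP->; rewrite !linear0.
Qed.

Lemma cact_cdiff i s c : c \in Csp K G i j ->
  cact K G j s (cdiff K G j c) = cdiff K G j (cact K G j s c).
Proof.
move=> cC; apply/ffunP=> F; rewrite cactE !cdiffE.
rewrite (linear_sum (@gact K V j s)) linear_sum /=.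
apply: eq_bigr => k _; rewrite !linearZ /= cactE dedge_gact ?subsetUr //.
exact: (Csp_Mmod _ cC).
Qed.

Lemma cyclesP i c :
  (c \in cycles K G i j) = (c \in Csp K G i j) && (cdiff K G j c == 0).
Proof. by rewrite memv_cap memv_ker. Qed.

Lemma cact_cycles i s c :
  c \in cycles K G i j -> cact K G j s c \in cycles K G i j.
Proof.
rewrite !cyclesP => /andP[cC /eqP dc]; rewrite cact_Csp //=.
by rewrite -(cact_cdiff s cC) dc linear0.
Qed.

Lemma cact_boundaries i s c :
  c \in boundaries K G i j -> cact K G j s c \in boundaries K G i j.
Proof.
case/memv_imgP=> b bC ->; rewrite (cact_cdiff s bC).
by apply: memv_img; exact: cact_Csp.
Qed.

End Differential.

(* On the states containing e' the complex C(G) is the cone of an isomorphism,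
   the maps deleting e being identities; [contract] inverts these identities
   with the sign of the deletion. *)
Section ParallelEdges.
Variables (m : nat) (G : mgraph V m) (j : nat) (e e' : 'I_m).
Hypotheses (ne : e != e') (parallel : ends G e = ends G e').
Implicit Types (F : {set 'I_m}) (c : chain m j).

Definition contract c : chain m j :=
  [ffun F : {set 'I_m} =>
    if (e \in F) && (e' \in F) then esign F e *: c (F :\ e) else 0].

Lemma component_addl F :
  e' \in F -> component G (e |: F) = component G F.
Proof.
move=> eF; apply: component_imset; rewrite imsetU1 parallel.
by apply/setUidPr; rewrite sub1set imset_f.
Qed.

Lemma component_addr F :
  e \in F -> component G (e' |: F) = component G F.
Proof.
move=> eF; apply: component_imset; rewrite imsetU1 -parallel.
by apply/setUidPr; rewrite sub1set imset_f.
Qed.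

Lemma component_swap F :
  component G (e |: F) = component G (e' |: F).
Proof. by apply: component_imset; rewrite !imsetU1 parallel. Qed.

Lemma esign_swap (k l : 'I_m) : k != l ->
  ((-1) ^+ (k < l)%N : K) = - (-1) ^+ (l < k)%N.
Proof.
by rewrite -val_eqE /=; case: ltngtP; rewrite // expr1 expr0 ?opprK.
Qed.

Section Lift.
Variable c : chain m j.
Hypotheses (cM : forall F, c F \in Mmod K G j F)
  (dc : forall F : {set 'I_m}, e' \in F -> cdiff K G j c F = 0).

(** In the vanishing coordinate of dc at F, the deletion of e is an identity because e' stays; its
    summand is isolated on the right. *)
Lemma cdiff_parallel F : e \notin F -> e' \in F ->
  \sum_(k | k \notin e |: F) esign F k *: dedge G (k |: F) F (c (k |: F))
    = - (esign F e *: c (e |: F)).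
Proof.
move=> eF e'F; have := dc e'F; rewrite cdiffE (bigD1 e) //=.
rewrite dedge_id ?component_addl // addrC => /eqP; rewrite addr_eq0 => /eqP <-.
by apply: eq_bigl => k; rewrite !inE negb_or andbC.
Qed.

(** With s for [contract], this is the homotopy identity ds + sd = 1 on C(G) / C', applied to a
    chain whose differential vanishes there. *)
Lemma cdiff_contract F : e' \in F -> cdiff K G j (contract c) F = c F.
Proof.
move=> e'F; rewrite cdiffE; case: (boolP (e \in F)) => eF; last first.
  (* [contract c] is supported on the states containing both edges, so only the deletion of e
     contributes; its sign cancels the one in [contract]. *)
  rewrite (bigD1 e) //= big1 ?addr0 => [|k /andP[kF ke]]; last first.
    by rewrite ffunE !inE eq_sym (negPf ke) (negPf eF) /= linear0 scaler0.
  rewrite ffunE !inE eqxx e'F orbT /= setU1K // linearZ /= scalerA.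
  rewrite esignU // ltnn mul1r esign_sqr scale1r dedge_id ?component_addl //.
  by rewrite (Mmod_ext K (component_addl e'F)).
have [F0 eF0 EF] : exists2 F0 : {set 'I_m}, e \notin F0 & F = e |: F0.
  by exists (F :\ e); rewrite ?setD1K // !inE eqxx.
rewrite {}EF {eF} in e'F *.
have {}e'F : e' \in F0 by move: e'F; rewrite !inE eq_sym (negPf ne).
(* Since e' lies in F0, deleting k is the same map with or without e. The sum is therefore that of
   dc at F0 without its e term, up to sign. *)
transitivity (- esign F0 e *: \sum_(k | k \notin e |: F0)
    esign F0 k *: dedge G (k |: F0) F0 (c (k |: F0))); last first.
  by rewrite cdiff_parallel // scaleNr scalerN opprK scalerA esign_sqr scale1r.
rewrite scaler_sumr.
apply: eq_bigr => k kEF.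
have /andP[ke kF] : (k != e) && (k \notin F0) by move: kEF; rewrite !inE negb_or.
have ekF : e \notin k |: F0 by rewrite !inE negb_or eq_sym ke.
rewrite ffunE !inE eqxx e'F !orbT /= setUCA setU1K // linearZ /= !scalerA.
rewrite (dedge_ext (G' := G) (F1' := k |: F0) (F2' := F0))
  ?component_addl ?inE ?e'F ?orbT //.
congr (_ *: _); rewrite !esignU // ltnn mul1r (esign_swap ke).
rewrite mulrA -[X in X * _]mulrA.
by case: (k < e)%N; case: (e < k)%N; ring.
Qed.

(** Only adding e' reaches the support of [contract c], and deleting e' is an identity because e
    stays. The value is thus that of c, up to sign, at F with e traded for e'. *)
Lemma cdiff_contract_inl F : e \in F -> e' \notin F ->
  cdiff K G j (contract c) F
    = (esign F e' * esign (e' |: F) e) *: c (e' |: (F :\ e)).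
Proof.
move=> eF e'F; rewrite cdiffE (bigD1 e') //= big1 ?addr0; last first.
  move=> k /andP[kF ke]; rewrite ffunE !inE (negPf e'F) orbF [e' == k]eq_sym.
  by rewrite (negPf ke) andbF linear0 scaler0.
have E : (e' |: F) :\ e = e' |: F :\ e.
  apply/setP=> k; rewrite !inE.
  by case: (eqVneq k e') => [->|] //; rewrite eq_sym ne.
rewrite ffunE !inE eqxx eF orbT /= E linearZ /= scalerA dedge_id //.
  exact: component_addr.
by rewrite (Mmod_ext K (component_addr eF)) -{2}(setD1K eF)
  (Mmod_ext K (component_swap _)).
Qed.

(** Such a state lacks two edges of any state in the support of [contract c]. *)
Lemma cdiff_contract_out F : e \notin F -> e' \notin F ->
  cdiff K G j (contract c) F = 0.
Proof.
move=> eF e'F; rewrite cdiffE big1 // => k kF; rewrite ffunE !inE.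
case: eqVneq => [<-|_]; last by rewrite (negPf eF) /= linear0 scaler0.
by rewrite eq_sym (negPf ne) (negPf e'F) andbF linear0 scaler0.
Qed.

(** The coordinates of d ([contract c]) are known explicitly from the preceding lemmas; the cases
    follow which of e and e' lie in F. *)
Lemma cdiff2_contract : cdiff K G j (cdiff K G j (contract c)) = 0.
Proof.
apply/ffunP=> F; rewrite [RHS]ffunE.
have [e'F|e'F] := boolP (e' \in F).
  (* All states above F contain e', and there d ([contract c]) equals c. *)
  rewrite -[RHS](dc e'F) !cdiffE; apply: eq_bigr => k _.
  by rewrite cdiff_contract // !inE e'F orbT.
have [eF|eF] := boolP (e \in F); last first.
  (* Only [e |: F] and [e' |: F] contribute. Both carry c ([e' |: F]) up to sign and have the same
     components, and the two signs are opposite. *)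
  rewrite cdiffE (bigD1 e) //= (bigD1 e') ?e'F 1?eq_sym //= big1; last first.
    move=> k /andP[/andP[kF ke] ke'].
    by rewrite cdiff_contract_out ?linear0 ?scaler0 // !inE negb_or eq_sym ?ke ?ke'.
  have e'eF : e' \notin e |: F by rewrite !inE negb_or eq_sym ne.
  rewrite addr0 (cdiff_contract (setU11 e' F)) (cdiff_contract_inl (setU11 e F)) //.
  rewrite setU1K // linearZ /= scalerA.
  rewrite (dedge_ext _ (component_swap F) (erefl _)) -scalerDl.
  suff -> : esign F e * (esign (e |: F) e' * esign (e' |: (e |: F)) e)
    = - esign F e' by rewrite addNr scale0r.
  rewrite !esignU // ltnn (esign_swap ne) mul1r.
  transitivity (- (esign F e * esign F e)
    * ((-1) ^+ (e' < e)%N * (-1) ^+ (e' < e)%N) * esign F e'); first by ring.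
  by rewrite esign_sqr -expr2 sqrr_sign mulN1r mulN1r.
have [F0 eF0 EF] : exists2 F0 : {set 'I_m}, e \notin F0 & F = e |: F0.
  by exists (F :\ e); rewrite ?setD1K // !inE eqxx.
have e'F0 : e' \notin F0 by apply: contra e'F => e'F0; rewrite EF !inE e'F0 orbT.
rewrite {}EF {eF} in e'F *.
have eE : e \notin e' |: F0 by rewrite !inE negb_or ne.
(* Here F is [e |: F0]. The deletion of e' contributes c ([e' |: F]) up to sign; trading e for e'
   turns the other terms into the sum in [ES], which cancels it. *)
have ES := cdiff_parallel eE (setU11 e' F0).
rewrite cdiffE (bigD1 e') //= cdiff_contract ?setU11 //.
rewrite dedge_id ?component_addr ?setU11 //.
have -> : \sum_(k | (k \notin e |: F0) && (k != e')) esign (e |: F0) k *: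
    dedge G (k |: (e |: F0)) (e |: F0)
      (cdiff K G j (contract c) (k |: (e |: F0)))
    = - (esign F0 e * esign F0 e') *: (\sum_(k | k \notin e |: (e' |: F0))
      esign (e' |: F0) k *: dedge G (k |: (e' |: F0)) (e' |: F0)
        (c (k |: (e' |: F0)))).
  rewrite scaler_sumr; apply: eq_big => [k|k /andP[]].
    by rewrite !inE !negb_or -!andbA [(k \notin F0) && _]andbC.
  rewrite !inE negb_or => /andP[ke kF0] ke'.
  have ekF : e \notin k |: F0 by rewrite !inE negb_or eq_sym ke.
  have kF : k \notin e |: F0 by rewrite !inE negb_or ke.
  have e'kF : e' \notin k |: (e |: F0).
    by rewrite !inE !negb_or eq_sym ke' eq_sym ne.
  rewrite (cdiff_contract_inl (setU1r k (setU11 e F0))) //.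
  have -> : e' |: (k |: (e |: F0)) :\ e = k |: (e' |: F0).
    by rewrite [k |: (e |: _)]setUCA setU1K // setUCA.
  rewrite linearZ /= !scalerA (dedge_ext (G' := G) (F1' := k |: (e' |: F0))
    (F2' := e' |: F0)) ?component_swap //; last first.
    by rewrite setUCA component_swap setUCA.
  congr (_ *: _); rewrite !esignU // ltnn (esign_swap ke) (esign_swap ke').
  rewrite (esign_swap ne).
  transitivity (((-1) ^+ (e < k)%N * (-1) ^+ (e < k)%N)
    * ((-1) ^+ (e' < e)%N * (-1) ^+ (e' < e)%N) * (-1) ^+ (e' < k)%N
    * esign F0 k * esign F0 e' * esign F0 e); first by ring.
  by rewrite -!expr2 !sqrr_sign; ring.
rewrite ES setUCA scaleNr scalerN opprK scalerA -scalerDl.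
suff -> : esign (e |: F0) e' + esign F0 e * esign F0 e' * esign (e' |: F0) e = 0.
  by rewrite scale0r.
rewrite !esignU // (esign_swap ne).
transitivity ((1 - esign F0 e * esign F0 e) * (-1) ^+ (e' < e)%N * esign F0 e').
  by ring.
by rewrite esign_sqr subrr !mul0r.
Qed.

End Lift.
Lemma contract_Csp i c : c \in Csp K G i j -> contract c \in Csp K G i.+1 j.
Proof.
move=> /CspP cP; apply/CspP=> F; rewrite ffunE.
case: ifPn => [/andP[eF e'F]|_]; last by rewrite mem0v.
have e'Fe : e' \in F :\ e by rewrite !inE eq_sym ne.
have := cP (F :\ e); rewrite -(Mmod_ext K (component_addl e'Fe)) setD1K //.
by rewrite [#|F|](cardsD1 e) eF add1n eqSS => cF; exact: memvZ.
Qed.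

End ParallelEdges.

(** * Chains of G - e' as the subcomplex C' *)

Section Deletion.
Variables (m : nat) (G : mgraph V m) (j : nat) (e' : 'I_m).
Local Notation G' := (delete_edge G e').
Implicit Types c : chain m.-1 j.

(** Extension by zero, with states of G - e' read in G through [lift e']; its image on chains is
    C'. *)
Definition extend_chain c : chain m j :=
  [ffun F : {set 'I_m} => if e' \in F then 0 else c (lift e' @^-1: F)].

Fact extend_chain_is_linear : linear extend_chain.
Proof.
move=> k c d; apply/ffunP=> F; rewrite !ffunE.
by case: ifP => // _; rewrite scaler0 addr0.
Qed.
HB.instance Definition _ :=
  GRing.isLinear.Build K (chain m.-1 j) (chain m j) *:%R extend_chain
    extend_chain_is_linear.

Lemma notin_lift_imset (F : {set 'I_m.-1}) : e' \notin lift e' @: F.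
Proof. by apply/imsetP=> -[k _ /eqP]; rewrite (negPf (neq_lift _ _)). Qed.

Lemma lift_preimsetK (F : {set 'I_m}) :
  e' \notin F -> lift e' @: (lift e' @^-1: F) = F.
Proof.
move=> e'F; apply/setP=> k; apply/imsetP/idP=> [[l]|kF].
  by rewrite inE => lF ->.
case: (unliftP e' k) kF => [l -> lF|->]; last by rewrite (negPf e'F).
by exists l; rewrite ?inE.
Qed.

Lemma lift_imset_ends (F : {set 'I_m.-1}) :
  ends G @: (lift e' @: F) = ends G' @: F.
Proof. by rewrite -imset_comp. Qed.

Lemma component_lift (F : {set 'I_m.-1}) :
  component G (lift e' @: F) = component G' F.
Proof. exact/component_imset/lift_imset_ends. Qed.

Lemma extend_chain_lift c (F : {set 'I_m.-1}) :
  extend_chain c (lift e' @: F) = c F.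
Proof.
rewrite ffunE (negPf (notin_lift_imset F)); congr (c _); apply/setP=> k.
by rewrite inE mem_imset //; exact: lift_inj.
Qed.

Lemma extend_chain_notin c (F : {set 'I_m}) : e' \in F -> extend_chain c F = 0.
Proof. by rewrite ffunE => ->. Qed.

Lemma extend_chain_inj : injective extend_chain.
Proof.
by move=> c d cd; apply/ffunP=> F; rewrite -!extend_chain_lift cd.
Qed.

Lemma extend_chain_Csp i c :
  (extend_chain c \in Csp K G i j) = (c \in Csp K G' i j).
Proof.
apply/CspP/CspP=> cP F.
  have := cP (lift e' @: F); rewrite extend_chain_lift card_imset.
    by rewrite (Mmod_ext K (component_lift F)).
  exact: lift_inj.
have [e'F|e'F] := boolP (e' \in F).
  by rewrite extend_chain_notin // mem0v.
rewrite -(lift_preimsetK e'F) extend_chain_lift card_imset; last exact: lift_inj.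
by rewrite (Mmod_ext K (component_lift _)).
Qed.

(** The renumbering [lift e'] is increasing and e' is absent from the state, so the number of later
    ones does not change. *)
Lemma esign_lift (F : {set 'I_m.-1}) k :
  esign (lift e' @: F) (lift e' k) = esign F k :> K.
Proof.
rewrite /esign /ones_after; congr (_ ^+ _).
rewrite -(card_imset _ (@lift_inj _ e')); apply: eq_card => l; rewrite !inE.
case: (unliftP e' l) => [l' ->|->]; last first.
  rewrite (negPf (notin_lift_imset _)); symmetry; apply/negbTE.
  exact: notin_lift_imset.
rewrite !mem_imset ?inE; try exact: lift_inj.
by rewrite !ltnNge /= leq_bump2.
Qed.

Lemma cdiff_extend_chain c :
  cdiff K G j (extend_chain c) = extend_chain (cdiff K G' j c).
Proof.
apply/ffunP=> F; rewrite cdiffE; have [e'F|e'F] := boolP (e' \in F).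
  rewrite [RHS]extend_chain_notin // big1 // => k _.
  by rewrite extend_chain_notin ?setU1r // linear0 scaler0.
(* The edges of G are split into e' and the [lift e' k]; the e' term is zero because an extended
   chain vanishes at [e' |: F]. *)
rewrite (bigD1_ord e') //= extend_chain_notin ?setU11 // linear0 scaler0 add0r.
rewrite -(lift_preimsetK e'F); set F' := lift e' @^-1: F.
rewrite extend_chain_lift cdiffE; apply: eq_big => k.
  by rewrite mem_imset //; exact: lift_inj.
move=> _; rewrite esign_lift -imsetU1 extend_chain_lift.
by rewrite (dedge_ext _ (component_lift _) (component_lift _)).
Qed.

Lemma cact_extend_chain s c :
  cact K G j s (extend_chain c) = extend_chain (cact K G' j s c).
Proof.
apply/ffunP=> F; rewrite cactE; have [e'F|e'F] := boolP (e' \in F).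
  by rewrite !extend_chain_notin // !linear0.
rewrite -(lift_preimsetK e'F) !extend_chain_lift cactE.
by rewrite (Mpi_ext K (component_lift _)).
Qed.

Lemma extend_chain_surj (c : chain m j) :
  (forall F : {set 'I_m}, e' \in F -> c F = 0) ->
  exists c', c = extend_chain c'.
Proof.
move=> c0; exists [ffun F : {set 'I_m.-1} => c (lift e' @: F)].
apply/ffunP=> F; have [e'F|e'F] := boolP (e' \in F).
  by rewrite c0 // extend_chain_notin.
by rewrite -(lift_preimsetK e'F) extend_chain_lift ffunE.
Qed.

(** The hypothesis says that c is a cycle modulo C', which covers both cycles of G and chains with
    boundary in C'. With b the contraction of c, c - db vanishes on the states containing e', hence
    comes from G - e'. *)
Lemma parallel_decomposition e i (c : chain m j) :
  e != e' -> ends G e = ends G e' -> c \in Csp K G i j ->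
  (forall F : {set 'I_m}, e' \in F -> cdiff K G j c F = 0) ->
  exists c' b, [/\ c' \in Csp K G' i j, b \in Csp K G i.+1 j,
    c = extend_chain c' + cdiff K G j b & cdiff K G j (cdiff K G j b) = 0].
Proof.
move=> ne parallel cC dc; pose b := contract e e' c.
have cM F : c F \in Mmod K G j F by exact: Csp_Mmod cC.
have bC : b \in Csp K G i.+1 j by exact: contract_Csp.
have [c' Ec'] : exists c', c - cdiff K G j b = extend_chain c'.
  apply: extend_chain_surj => F e'F.
  by rewrite !ffunE cdiff_contract ?subrr.
exists c', b; split=> //.
- by rewrite -extend_chain_Csp -Ec' rpredB // cdiff_Csp.
- by rewrite -Ec' subrK.
- exact: cdiff2_contract.
Qed.

End Deletion.

(** * The isomorphism in homology *)

Theorem homology_iso_delete_parallel m (G : mgraph V m) (e e' : 'I_m) :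
  e != e' -> ends G e = ends G e' -> homology_iso K G (delete_edge G e').
Proof.
move=> ne parallel i j; apply: smod_iso_sym.
  by move=> s c _; rewrite comp_lfunE quot_pi_in.
have extE c : linfun (@extend_chain m j e') c = extend_chain e' c by rewrite lfunE.
apply: (smod_iso_quotv (f := linfun (@extend_chain m j e'))).
- exact: cact_cycles.
- move=> s c /memv_capP[cZ cB]; apply/memv_capP.
  by split; [exact: cact_cycles | exact: cact_boundaries].
- exact: cact_cycles.
- move=> c; rewrite extE !cyclesP extend_chain_Csp => /andP[-> /eqP dc] /=.
  by rewrite cdiff_extend_chain dc raddf0.
- move=> _ /memv_capP[_ /memv_imgP[b bC ->]]; rewrite extE.
  by rewrite -cdiff_extend_chain memv_img // extend_chain_Csp.
(* Injectivity: if the extension of c is db, then b is a cycle modulo C', so b is an extended chain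
   plus some da with dda = 0, and the extended chain has the same boundary. *)
- move=> c _; rewrite extE => /memv_imgP[b bC Ec].
  have [|b' [a [b'C aC Eb dda]]] := parallel_decomposition ne parallel bC.
    by move=> F e'F; rewrite -Ec extend_chain_notin.
  apply/memv_imgP; exists b' => //; apply: (@extend_chain_inj m j e').
  by rewrite Ec Eb linearD /= dda addr0 cdiff_extend_chain.
(* Surjectivity: a cycle differs from an extended chain by some db, and ddb = 0 makes that chain a
   cycle. *)
- move=> c; rewrite cyclesP => /andP[cC /eqP dc].
  have [|c' [b [c'C bC Ec ddb]]] := parallel_decomposition ne parallel cC.
    by move=> F _; rewrite dc ffunE.
  exists c'; last by rewrite extE Ec addrC addKr memv_img.
  rewrite cyclesP c'C /=; apply/eqP/(@extend_chain_inj m j e').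
  by rewrite -cdiff_extend_chain raddf0 -dc Ec linearD /= ddb addr0.
- by move=> s c _; rewrite !extE cact_extend_chain.
Qed.

End Chains.

Theorem proposition3p2 (R : realType) (V : finType) (m : nat)
  (G : mgraph V m) (e e' : 'I_m) (x y : V)
  (hne : e != e')
  (he : ends G e = [set x; y])
  (he' : ends G e' = [set x; y]) :
  homology_iso R[i] G (delete_edge G e').
Proof. by apply: homology_iso_delete_parallel hne _; rewrite he he'. Qed.
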